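(* Let $k,l$ be given positive integers with $\gcd(k,l)=1$ and $1\le l<k$, and let $Q_i$ denote the $i$-th prime of the form $kx+l$. Assume that both of the following hypotheses hold. (Conjecture 3) There is a positive constant $C_8$ such that for every integer $n>C_8$ there exists $r>1$ such that $kn+l>Q_r$, $\gcd(kn+l,Q_r)=1$, and $2(kn+l)-Q_r$ is coprime to $2(kn+l)-Q$ for every prime $Q\le kn+l$ of the form $kx+l$ with $Q\neq Q_r$. (Conjecture 4) For every real number $\varepsilon$ with $0<\varepsilon<0.5$ there is a positive constant $C_9$ such that for every integer $d>C_9$ with $\gcd(d,k)=1$ and every positive integer $a$ with $1\le a<d$ and $\gcd(a,d)=1$, there is a prime $q$ such that $q<(dk)^{2-\varepsilon}$, $q\equiv a \pmod d$ and $q\equiv l\pmod k$. Then for every sufficiently large integer $n$, $2(kn+l)$ can be written as the sum of two distinct primes $p,q$ satisfying $p\equiv q\equiv l \pmod k$.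
   Context: A prime ''of the form $kx+l$'' means a prime congruent to $l$ modulo $k$ (i.e. $x$ is a nonnegative integer); these primes are listed in increasing order as $Q_1<Q_2<\cdots$. *)

(* Defs.v *)
From HB Require Import structures.
From mathcomp Require Import all_boot all_order all_algebra.
From mathcomp Require Import all_classical all_reals all_analysis.
Set Implicit Arguments.
Unset Strict Implicit.
Unset Printing Implicit Defensive.
Import Order.TTheory GRing.Theory Num.Theory.
Local Open Scope ring_scope.

Definition prime_of_form (k l q : nat) : bool :=
  prime q && (q == l %[mod k])%N.

(* [q = Q_i], where Q_1 < Q_2 < ... are the primes congruent to [l] mod [k]:
   exactly [i] of these primes are at most [q], and [q] is one of them.  It is
   a relation because a function of [i] would be total only given Dirichlet's
   theorem. *)
Definition nth_prime_of_form (k l i q : nat) : bool :=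
  prime_of_form k l q && (count (prime_of_form k l) (iota 0 q.+1) == i)%N.

(* The natural subtractions below do not truncate: [Qr] and [Q] are at most
   [k * n + l]. *)
Definition coprime_difference_conjecture (R : realType) (k l : nat) : Prop :=
  exists C8 : R, 0 < C8 /\
    forall n : nat, C8 < n%:R ->
      exists r Qr : nat,
        [/\ (1 < r)%N, nth_prime_of_form k l r Qr, (Qr < k * n + l)%N,
            coprime (k * n + l) Qr
          & forall Q : nat, prime_of_form k l Q -> (Q <= k * n + l)%N ->
              Q <> Qr ->
              coprime (2 * (k * n + l) - Qr) (2 * (k * n + l) - Q)].

Definition least_prime_conjecture (R : realType) (k l : nat) : Prop :=
  forall eps : R, 0 < eps -> eps < 2^-1 ->
    exists C9 : R, 0 < C9 /\
      forall d : nat, C9 < d%:R -> coprime d k ->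
        forall a : nat, (1 <= a < d)%N -> coprime a d ->
          exists q : nat,
            [/\ prime q, q%:R < (d * k)%:R `^ (2 - eps),
                q = a %[mod d] & q = l %[mod k]].

(* Main.v *)
Require Import Defs.
From mathcomp Require Import all_boot all_order all_algebra.
From mathcomp Require Import all_classical all_reals all_analysis.
From mathcomp Require Import zify.
Import Order.TTheory GRing.Theory Num.Theory.

(** Put [N = k * n + l] and let [Q] be the prime [Q_r] that the coprimality
    hypothesis attaches to [n].  The two primes are [Q] and [2 * N - Q]; both
    are congruent to [l] modulo [k], and they differ because [Q < N].

    The point is that [2 * N - Q] is prime.  Otherwise it has a prime factor
    [d] with [d ^ 2 < 2 * N].  A prime [q <= N] of the form [k * x + l], with
    [q <> Q] but [q = Q] modulo [d], would make [d] a common factor of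
    [2 * N - Q] and [2 * N - q], against the choice of [Q].  The least prime
    hypothesis produces such a [q], but applied with modulus [d] it is not
    enough: [d] may be too small for it, and the prime obtained could be [Q]
    itself.  Both defects disappear on replacing [d] by [d * m], where [m] is
    a fixed large prime, and the class of [Q] by a class [Q + t * d] with
    [t = 1] or [t = 2]: it is still [Q] modulo [d], but no longer [Q] modulo
    [d * m], and one of the two choices is coprime to [d * m]
    ([coprime_shift]).  As [m] does not depend on [n], the bound
    [(d * m * k) ^ (7 / 4)] on [q] is [O(N ^ (7 / 8))], hence below [N] for
    large [n] ([eventually_lt_of_pow_bounds]). *)

(** Only a first prime of the progression can be [2], as no prime is smaller;
    so the condition [1 < r] is what makes [Q_r] odd. *)
Lemma nth_prime_of_form_gt2 {k l r q : nat} :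
  nth_prime_of_form k l r q -> (1 < r)%N -> (2 < q)%N.
Proof.
move=> /andP[qF /eqP cnt] r1.
have pq : prime q by case/andP: qF.
rewrite ltn_neqAle prime_gt1 // andbT; apply/eqP => q2; move: cnt r1.
by rewrite -q2 /= /prime_of_form /= => <-; case: eqP.
Qed.

(** If [m] divided both [Q + d] and [Q + 2 * d], it would divide [d] and [Q],
    which are coprime. *)
Lemma coprime_shift {Q d m : nat} : prime m -> coprime Q d ->
  exists t : nat, (0 < t <= 2)%N /\ coprime (Q + t * d) (d * m).
Proof.
move=> pm cQd.
have cd t : coprime (Q + t * d) d.
  by rewrite /coprime addnC gcdnC gcdnMDl gcdnC.
have [m1|m1] := boolP (m %| Q + 1 * d); last first.
  by exists 1%N; split=> //; rewrite coprimeMr cd coprime_sym prime_coprime.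
exists 2%N; split=> //; rewrite coprimeMr cd coprime_sym prime_coprime //=.
apply/negP => m2; have md : m %| d.
  by rewrite -(dvdn_addr d m1) (_ : _ + d = Q + 2 * d)%N //; lia.
have mQ : m %| Q by rewrite -(dvdn_addl Q (dvdn_mull 1 md)).
have : m %| gcdn Q d by rewrite dvdn_gcd mQ.
by rewrite (eqP cQd) dvdn1 => /eqP m_eq1; rewrite m_eq1 in pm.
Qed.

Lemma composite_small_prime_factor {M : nat} : (1 < M)%N -> ~~ prime M ->
  exists d : nat, [/\ prime d, d %| M & (d ^ 2 <= M)%N].
Proof.
move=> M1 nM; exists (pdiv M); split; [exact: pdiv_prime|exact: pdiv_dvd|].
by rewrite leqNgt; apply: contra nM => /ltn_pdiv2_prime -> //; lia.
Qed.

Lemma ltn_pow_of_powR {R : realType} {q x : nat} :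
  (q%:R < x%:R `^ (2 - 4^-1) :> R)%R -> (q ^ 4 < x ^ 7)%N.
Proof.
move=> qx; rewrite -(ltr_nat R) !natrX.
have : (q%:R ^+ 4 < (x%:R `^ (2 - 4^-1)) ^+ 4 :> R)%R.
  by rewrite ltr_pXn2r ?nnegrE ?powR_ge0.
rewrite -(@powR_mulrn _ (_ `^ _)) ?powR_ge0 // -powRrM.
have -> : ((2 - 4^-1) * 4%:R = 7%:R :> R)%R.
  by rewrite mulrBl mulVf ?pnatr_eq0 // -natrM -(natrB R (isT : 1 <= 2 * 4)%N).
by rewrite powR_mulrn.
Qed.

(** With [d = O(N ^ (1 / 2))] and [b] fixed, [(d * b) ^ (7 / 4)] is
    [O(N ^ (7 / 8))]. *)
Lemma eventually_lt_of_pow_bounds (b : nat) :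
  exists T : nat, forall N d q : nat, (T <= N)%N -> (d ^ 2 <= 2 * N)%N ->
    (q ^ 4 < (d * b) ^ 7)%N -> (q < N)%N.
Proof.
exists ((2 * b ^ 2) ^ 7)%N => N d q N_ge dN qx.
rewrite -(ltn_exp2r _ _ (isT : 0 < 8)%N).
have : ((q ^ 4) ^ 2 < ((d * b) ^ 7) ^ 2)%N by rewrite ltn_exp2r.
rewrite -!expnM => /leq_trans; apply.
rewrite (_ : 7 * 2 = 2 * 7)%N // expnM expnMn.
apply: (@leq_trans ((2 * b ^ 2 * N) ^ 7)%N).
  by rewrite leq_exp2r // mulnAC leq_mul2r dN orbT.
by rewrite expnMn [(N ^ 8)%N]expnS leq_mul2r N_ge orbT.
Qed.

(** The least prime hypothesis with exponent [7 / 4], made to avoid a given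
    [Q]: enlarging the modulus by the fixed factor [m] removes the lower bound
    on the modulus and leaves room for a class other than that of [Q]. *)
Lemma least_prime_avoiding {R : realType} {k l : nat} :
  least_prime_conjecture R k l ->
  exists m : nat, forall d Q : nat, (0 < d)%N -> (0 < k)%N ->
    coprime d k -> coprime Q d ->
    exists q : nat, [/\ prime_of_form k l q, (q ^ 4 < (d * m * k) ^ 7)%N,
      q = Q %[mod d] & q <> Q].
Proof.
move=> conj4.
have [C9 [C9_gt0 conj4']] : exists C9 : R, (0 < C9)%R /\
    forall d : nat, (C9 < d%:R)%R -> coprime d k ->
    forall a : nat, (1 <= a < d)%N -> coprime a d ->
    exists q : nat, [/\ prime q, (q%:R < (d * k)%:R `^ (2 - 4^-1) :> R)%R,
      q = a %[mod d] & q = l %[mod k]].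
  by apply: conj4; rewrite ?invr_gt0 ?ltf_pV2 ?posrE ?ltr0n ?ltr_nat.
pose B := Num.bound C9.
(* [m > B] makes [d * m] large enough, [m > k] makes it coprime to [k], and
   [m > 2 >= t] separates [Q + t * d] from [Q] modulo [d * m]. *)
have [m m_gt m_prime] := prime_above (maxn B (maxn k 2)).
exists m => d Q d_gt0 k_gt0 cdk cQd.
have [t [/andP[t_gt0 t_le2] ct]] := coprime_shift m_prime cQd.
have [mB mk m2] : [/\ B < m, k < m & 2 < m]%N by split; lia.
have dm_gt2 : (2 < d * m)%N by rewrite (leq_trans m2) ?leq_pmull.
have C9_lt : (C9 < (d * m)%:R)%R.
  apply: lt_le_trans (archi_boundP (ltW C9_gt0)) _.
  by rewrite ler_nat -/B (leq_trans (ltnW mB)) ?leq_pmull.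
have cdmk : coprime (d * m) k.
  by rewrite coprimeMl cdk prime_coprime // gtnNdvd.
have ca : coprime ((Q + t * d) %% (d * m)) (d * m) by rewrite coprime_modl.
have a_range : (1 <= (Q + t * d) %% (d * m) < d * m)%N.
  rewrite ltn_pmod ?(ltn_trans _ dm_gt2) // andbT lt0n.
  apply/eqP => a0; move: ca; rewrite a0 /coprime gcd0n => /eqP dm1.
  by rewrite dm1 in dm_gt2.
have [q [q_prime q_lt q_dm q_k]] := conj4' _ C9_lt cdmk _ a_range ca.
move: q_dm; rewrite modn_mod => q_dm.
exists q; split.
- by rewrite /prime_of_form q_prime q_k eqxx.
- exact: ltn_pow_of_powR q_lt.
- have /(congr1 (modn^~ d)) := q_dm.
  by rewrite !modn_dvdm ?dvdn_mulr // addnC modnMDl.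
- move=> qQ; move/eqP: q_dm; rewrite qQ -{1}[Q]addn0 eqn_modDl mod0n.
  have td_lt : (t * d < d * m)%N.
    by rewrite mulnC ltn_pmul2l // (leq_ltn_trans t_le2).
  by rewrite modn_small // eq_sym => /eqP td0; move: (muln_gt0 t d); rewrite td0 t_gt0 d_gt0.
Qed.

Theorem theorem2 (R : realType) (k l : nat)
    (hkl : coprime k l) (hl : (1 <= l < k)%N)
    (conj3 : coprime_difference_conjecture R k l)
    (conj4 : least_prime_conjecture R k l) :
  exists n0 : nat, forall n : nat, (n0 <= n)%N ->
    exists p q : nat,
      [/\ prime p, prime q, p <> q, (2 * (k * n + l) = p + q)%N
        & (p = l %[mod k]) /\ (q = l %[mod k])].
Proof.
have [C8 [C8_gt0 conj3']] := conj3.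
have [m avoid] := least_prime_avoiding conj4.
have [T below_N] := eventually_lt_of_pow_bounds (m * k).
exists (Num.bound C8 + T)%N => n n_ge.
have C8_lt : (C8 < n%:R)%R.
  apply: lt_le_trans (archi_boundP (ltW C8_gt0)) _.
  by rewrite ler_nat (leq_trans _ n_ge) // leq_addr.
have [r [Q [r_gt1 Q_nth Q_lt cNQ disj]]] := conj3' n C8_lt.
have Q_gt2 := nth_prime_of_form_gt2 Q_nth r_gt1.
have /andP[/andP[Q_prime /eqP Q_l] _] := Q_nth.
set N := (k * n + l)%N in Q_lt cNQ disj *.
have k_gt0 : (0 < k)%N by case/andP: hl; apply: ltn_trans.
have N_ge : (T <= N)%N.
  apply: leq_trans (leq_trans (leq_addl _ _) n_ge) _.
  by rewrite (leq_trans (leq_pmull n k_gt0)) ?leq_addr.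
have QM : (Q <= 2 * N)%N by lia.
have P_l : (2 * N - Q = l %[mod k])%N.
  apply/eqP; rewrite -(eqn_modDr Q) subnK // -(modnDmr l) Q_l modnDmr.
  by rewrite /N mulnDr mulnCA mulnC modnMDl mul2n addnn.
exists Q, (2 * N - Q)%N; split=> //; [|lia|by rewrite subnKC].
apply: contraT => P_comp.
have [|d [d_prime dP d_le]] := composite_small_prime_factor _ P_comp.
  by lia.
have cdk : coprime d k.
  by apply: coprime_dvdl dP _; rewrite -coprime_modl P_l coprime_modl coprime_sym.
(* [gcd (2 * N - Q) Q] divides [2 * N], and [Q] is odd and coprime to [N]. *)
have cQd : coprime Q d.
  rewrite coprime_sym; apply: coprime_dvdl dP _.
  rewrite coprime_sym /coprime -(gcdnDr Q) subnK // -/(coprime _ _) coprimeMr.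
  by rewrite [coprime Q N]coprime_sym cNQ andbT prime_coprime // gtnNdvd.
have [q [q_form q_lt q_d qQ]] := avoid d Q (prime_gt0 d_prime) k_gt0 cdk cQd.
have q_ltN : (q < N)%N.
  apply: below_N N_ge _ _; last by rewrite mulnA; exact: q_lt.
  by rewrite (leq_trans d_le) // leq_subr.
have dq : d %| 2 * N - q.
  rewrite -eqn_mod_dvd ?q_d ?eqn_mod_dvd //.
  by rewrite (leq_trans (ltnW q_ltN)) ?leq_pmull.
have : d %| gcdn (2 * N - Q) (2 * N - q) by rewrite dvdn_gcd dP.
rewrite (eqP (disj q q_form (ltnW q_ltN) qQ)) dvdn1 => /eqP d1.
by rewrite d1 in d_prime.
Qed.
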